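(* Let $\tau$ be an infinite cardinal, let $\mathcal G$ be a $\tau$-multiplicative and hereditary class of topological groups, and let $G$ be a range-$\mathcal G$ topological group. Let $(G,X,\alpha)$ be either (a) a $G$-space with transitive action and $\chi(X)\le\tau$, or (b) a $G$-Tychonoff space with an equiuniformity $\mathcal U$ on $X$ such that $w(\mathcal U)\le\tau$. Then there exist a topological group $H\in\mathcal G$ and a $G$-space $(H,X,\gamma)$ with transitive action $\gamma$ in case (a), respectively a $G$-Tychonoff space $(H,X,\gamma)$ for which $\mathcal U$ is an equiuniformity in case (b), and an equivariant pair of maps $(\varphi,\mathrm{id}):(G,X,\alpha)\to(H,X,\gamma)$ with $\varphi$ an epimorphism.
   Context: All spaces are Tychonoff and all maps continuous. A class $\mathcal G$ of topological groups is $\tau$-multiplicative if the product of (at most) $\tau$ members of $\mathcal G$ belongs to $\mathcal G$, and hereditary if every subgroup of a member of $\mathcal G$ belongs to $\mathcal G$. A topological group $G$ is range-$\mathcal G$ if for every neighborhood $O$ of the unit $e$ there are a continuous homomorphism $h:G\to H$ with $H\in\mathcal G$ and a neighborhood $U$ of the unit of $H$ with $h^{-1}(U)\subset O$ (equivalently, $G$ is topologically isomorphic to a subgroup of a product of members of $\mathcal G$). A $G$-space $(G,X,\alpha)$ is a topological group with a continuous action on $X$; transitive means $Gx=X$. An equivariant pair $(\varphi,\mathrm{id}):(G,X,\alpha)\to(H,X,\gamma)$ is a continuous homomorphism $\varphi$ with $\alpha(g,x)=\gamma(\varphi(g),x)$. Uniformities are families of open covers; $w(\mathcal U)$ is the minimal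 size of a base. An equiuniformity is a uniformity which is saturated ($gu\in\mathcal U$ for $g\in G,u\in\mathcal U$) and bounded (for each $u\in\mathcal U$ there exist a neighborhood $O$ of $e$ and $v\in\mathcal U$ with $\{OV:V\in v\}$ refining $u$). $G$-Tychonoff means there is a compactification of $X$ with a continuous $G$-action extending $\alpha$. *)

(* Defs.v *)
From HB Require Import structures.
From mathcomp Require Import all_boot all_order all_algebra.
From mathcomp Require Import all_classical all_reals all_analysis.
From mathcomp Require Import Rstruct Rstruct_topology.

Set Implicit Arguments.
Unset Strict Implicit.
Unset Printing Implicit Defensive.

Local Open Scope classical_set_scope.

Definition tychonoff_space (T : topologicalType) : Prop :=
  hausdorff_space T /\
  forall (A : set T) (x : T), closed A -> ~ A x ->
    exists f : T -> Rdefinitions.R,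
      continuous f /\ (forall y, (0 <= f y <= 1)%R) /\
      f x = 0%R /\ (forall y, A y -> f y = 1%R).

Record topGroup := TopGroup {
  tg_car :> topologicalType;
  tg_mul : tg_car -> tg_car -> tg_car;
  tg_inv : tg_car -> tg_car;
  tg_one : tg_car;
  tg_mulA : forall x y z, tg_mul x (tg_mul y z) = tg_mul (tg_mul x y) z;
  tg_mul1g : forall x, tg_mul tg_one x = x;
  tg_mulVg : forall x, tg_mul (tg_inv x) x = tg_one;
  tg_mul_cont : continuous (fun p : tg_car * tg_car => tg_mul p.1 p.2);
  tg_inv_cont : continuous tg_inv;
  tg_tychonoff : tychonoff_space tg_car }.

Definition cont_hom (G H : topGroup) (h : G -> H) : Prop :=
  continuous h /\ forall x y, h (tg_mul x y) = tg_mul (h x) (h y).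

Definition epimorphism (G H : topGroup) (h : G -> H) : Prop :=
  cont_hom h /\ forall y : H, exists x : G, h x = y.

Definition top_embedding (X Y : topologicalType) (j : X -> Y) : Prop :=
  injective j /\ continuous j /\
  forall U : set X, open U -> exists V : set Y, open V /\ j @^-1` V = U.

(** A cardinal is represented by a type [K]; "at most tau many" = indexed by
    a subset of [K]. *)

Definition tg_class := topGroup -> Prop.

Definition tau_multiplicative (K : Type) (cls : tg_class) : Prop :=
  forall (I : Type) (ι : I -> K), injective ι ->
  forall (Gs : I -> topGroup), (forall i, cls (Gs i)) ->
  forall (P : topGroup) (f : P -> prod_topology (fun i => tg_car (Gs i))),
    (forall x y i, f (tg_mul x y) i = tg_mul (f x i) (f y i)) ->
    continuous f ->
    (exists g : prod_topology (fun i => tg_car (Gs i)) -> P,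
        cancel f g /\ cancel g f /\ continuous g) ->
    cls P.

Definition hereditary (cls : tg_class) : Prop :=
  forall (H S : topGroup) (e : S -> H),
    cls H -> cont_hom e -> top_embedding e -> cls S.

Definition range_class (cls : tg_class) (G : topGroup) : Prop :=
  forall O : set G, nbhs (tg_one G) O ->
    exists (H : topGroup) (h : G -> H), cls H /\ cont_hom h /\
      exists U : set H, nbhs (tg_one H) U /\ h @^-1` U `<=` O.

Definition is_action (G : topGroup) (X : topologicalType) (a : G -> X -> X) : Prop :=
  (forall x, a (tg_one G) x = x) /\
  (forall g h x, a g (a h x) = a (tg_mul g h) x) /\
  continuous (fun p : G * X => a p.1 p.2).

Definition transitive_action (G : topGroup) (X : Type) (a : G -> X -> X) : Prop :=
  forall x y : X, exists g : G, a g x = y.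

Definition G_tychonoff (G : topGroup) (X : topologicalType) (a : G -> X -> X) : Prop :=
  exists (bX : topologicalType) (j : X -> bX) (b : G -> bX -> bX),
    compact [set: bX] /\ hausdorff_space bX /\ top_embedding j /\
    dense (range j) /\ is_action b /\
    forall g x, b g (j x) = j (a g x).

Definition character_le (K : Type) (X : topologicalType) : Prop :=
  forall x : X, exists (A : set K) (B : K -> set X),
    (forall k, A k -> open (B k) /\ B k x) /\
    (forall N, nbhs x N -> exists2 k, A k & B k `<=` N).

(** Uniformities as families of open covers. *)
Definition open_cover (X : topologicalType) (u : set (set X)) : Prop :=
  (forall V, u V -> open V) /\ (forall x, exists2 V, u V & V x).

Definition refines (X : Type) (u v : set (set X)) : Prop :=
  forall V, u V -> exists2 W, v W & V `<=` W.

Definition star (X : Type) (A : set X) (u : set (set X)) : set X :=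
  \bigcup_(V in [set V | u V /\ V `&` A !=set0]) V.

Definition star_refines (X : Type) (v u : set (set X)) : Prop :=
  refines [set star V v | V in v] u.

Definition uniformity (X : topologicalType) (U : set (set (set X))) : Prop :=
  U !=set0 /\
  (forall u, U u -> open_cover u) /\
  (forall u v, U u -> open_cover v -> refines u v -> U v) /\
  (forall u1 u2, U u1 -> U u2 -> exists2 u, U u & refines u u1 /\ refines u u2) /\
  (forall u, U u -> exists2 v, U v & star_refines v u) /\
  (forall x y : X, x <> y -> exists2 u, U u & forall V, u V -> ~ (V x /\ V y)) /\
  (forall (x : X) N, nbhs x N -> exists2 u, U u & star [set x] u `<=` N).

Definition uniformity_weight_le (K : Type) (X : Type) (U : set (set (set X))) : Prop :=
  exists (A : set K) (B : K -> set (set X)),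
    (forall k, A k -> U (B k)) /\
    (forall u, U u -> exists2 k, A k & refines (B k) u).

Definition act_set (G : topGroup) (X : Type) (a : G -> X -> X) (O : set G) (V : set X) : set X :=
  [set z | exists g y, O g /\ V y /\ z = a g y].

Definition equiuniformity (G : topGroup) (X : topologicalType) (a : G -> X -> X)
    (U : set (set (set X))) : Prop :=
  [/\ uniformity U,
      (forall (g : G) u, U u -> U [set (a g) @` V | V in u]) &
      (forall u, U u -> exists (O : set G) (v : set (set X)),
          nbhs (tg_one G) O /\ U v /\ refines [set act_set a O V | V in v] u)].

(* Main.v *)
Require Import Defs.
From HB Require Import structures.
From mathcomp Require Import all_boot all_order all_algebra.
From mathcomp Require Import all_classical all_reals all_analysis.
From mathcomp Require Import Rstruct Rstruct_topology.
From mathcomp Require Import ring.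

(** For every one of at most tau many neighborhoods [O_k] of the unit of [G]
    choose a homomorphism [h_k : G -> H_k] into a member of the class and a
    neighborhood of the unit of [H_k] whose preimage lies in [O_k].  The image
    [H] of the diagonal of the [h_k] is a subgroup of a product of at most tau
    members of the class.  The [O_k] are chosen so that the kernel acts
    trivially and the induced action of [H] is continuous: in the transitive
    case [O_k W_k] is contained in [B_k], where the [B_k] form a local base at a
    single point and the [W_k] are neighborhoods of that point; in the
    equiuniform case [{O_k V : V in v_k}] refines the [k]-th cover of a base of
    the uniformity, which also makes the uniformity bounded for [H].

    An equivariant compactification for [H] cannot be taken from the one given
    for [G], whose action need not factor through [H].  It is the closure of [X]
    in the cube [0,1]^F, where [F] is the set of all [U]-uniformly continuous
    functions: saturation lets the group permute [F], and boundedness says that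
    translation of functions is continuous for the uniform distance. *)

Set Implicit Arguments.
Unset Strict Implicit.
Unset Printing Implicit Defensive.

Import Order.TTheory GRing.Theory Num.Theory.
Import numFieldNormedType.Exports.

Local Open Scope classical_set_scope.

(** * Convergence and continuity in products and subspaces *)

Lemma cvg_initial (S : choiceType) (T : topologicalType) (f : S -> T)
    (F : set_system S) (s : S) : Filter F ->
  f @ F --> f s -> F --> (s : initial_topology f).
Proof.
move=> FF fFs A [_ [[B oB <-] Bs sBA]].
by apply: filterS sBA _; apply: fFs; apply: open_nbhs_nbhs; split.
Qed.

Lemma cvg_prod_topology (I : Type) (T : I -> topologicalType)
    (F : set_system (prod_topology T)) (t : prod_topology T) : Filter F ->
  (forall i, (fun p : prod_topology T => p i) @ F --> t i) -> F --> t.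
Proof.
by move=> FF Ft; apply/cvg_sup => i; apply: cvg_initial; exact: Ft.
Qed.

Lemma prod_topology_eval_continuous (I : Type) (T : I -> topologicalType)
    (i : I) : continuous (fun p : prod_topology T => p i).
Proof. exact: (@proj_continuous {classic I} T i). Qed.

Lemma continuous_prod_topology (S : topologicalType) (I : Type)
    (T : I -> topologicalType) (f : S -> prod_topology T) :
  (forall i, continuous (fun s => f s i)) -> continuous f.
Proof. by move=> cf s; apply: cvg_prod_topology => i; exact: cf. Qed.

Lemma continuous_set_type (S T : topologicalType) (A : set T)
    (f : S -> set_type A) :
  continuous (fun s => set_val (f s)) -> continuous f.
Proof. by move=> cf s; apply: cvg_initial; exact: cf. Qed.

Lemma set_val_continuous (T : topologicalType) (A : set T) :
  continuous (set_val : set_type A -> T).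
Proof. exact: initial_continuous. Qed.

Lemma hausdorff_injective (S T : topologicalType) (f : S -> T) :
  continuous f -> injective f -> hausdorff_space T -> hausdorff_space S.
Proof.
move=> cf fI hT x y xy; apply: fI; apply: hT => A B fxA fyB.
have [z [Az Bz]] := xy _ _ (cf _ _ fxA) (cf _ _ fyB).
by exists (f z).
Qed.

Lemma hausdorff_prod_topology (I : Type) (T : I -> topologicalType) :
  (forall i, hausdorff_space (T i)) -> hausdorff_space (prod_topology T).
Proof. exact: (@hausdorff_product {classic I} T). Qed.

(** * Complete regularity of products and subspaces *)

(** Stated as a family of sets [N] because this family is a filter: complete regularity at [x] then
    says that the filter converges to [x], which for initial topologies can be tested one map at a
    time. *)
Definition functionally_separated (T : topologicalType) (x : T) :
    set_system T := fun N => exists f : T -> Rdefinitions.R,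
    continuous f /\ (forall y, (0 <= f y <= 1)%R) /\
    f x = 0%R /\ (forall y, ~ N y -> f y = 1%R).

Lemma functionally_separated_filter (T : topologicalType) (x : T) :
  Filter (functionally_separated x).
Proof.
split.
- exists (fun=> 0%R); split; first by move=> ?; exact: cvg_cst.
  by split=> [y|]; [rewrite lexx ler01|split=> // y /(_ I)].
- move=> A B [f [cf [f01 [fx fA]]]] [g [cg [g01 [gx gB]]]].
  exists (fun y => Num.max (f y) (g y)); split; last split; last split.
  + by move=> y; apply: (@continuous_max Rdefinitions.R T f g);
      [exact: cf|exact: cg].
  + move=> y; have /andP[f0 f1] := f01 y; have /andP[g0 g1] := g01 y.
    by rewrite le_max f0 ge_max f1 g1.
  + by rewrite fx gx maxxx.
  + move=> y /not_andP[/fA->|/gB->].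
      by have /andP[_ g1] := g01 y; apply/max_idPl.
    by have /andP[_ f1] := f01 y; apply/max_idPr.
- move=> A B AB [f [cf [f01 [fx fA]]]].
  exists f; split=> //; split=> //; split=> //.
  by move=> y nBy; apply: fA => /AB.
Qed.

Lemma tychonoff_nbhs (T : topologicalType) : tychonoff_space T ->
  forall (x : T) N, nbhs x N -> functionally_separated x N.
Proof.
move=> [_ sepT] x N; rewrite nbhsE; case=> O [oO Ox] ON.
have [||f [cf [f01 [fx fO]]]] := sepT (~` O) x; first exact: open_closedC.
  by [].
by exists f; split=> //; split=> //; split=> //; move=> y nNy; apply: fO => /ON.
Qed.

Lemma nbhs_tychonoff (T : topologicalType) : hausdorff_space T ->
  (forall (x : T) N, nbhs x N -> functionally_separated x N) ->
  tychonoff_space T.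
Proof.
move=> hT sepT; split=> // A x cA nAx.
have [|f [cf [f01 [fx fA]]]] := sepT x (~` A).
  by apply: open_nbhs_nbhs; split=> //; exact: closed_openC.
by exists f; split=> //; split=> //; split=> //; move=> y Ay; apply: fA; apply.
Qed.

Lemma functionally_separated_preimage (S T : topologicalType) (f : S -> T)
    (x : S) (N : set T) : continuous f ->
  functionally_separated (f x) N -> functionally_separated x (f @^-1` N).
Proof.
move=> cf [g [cg [g01 [gx gN]]]]; exists (g \o f); split.
  by move=> y; apply: continuous_comp; [exact: cf|exact: cg].
split; first by move=> y; exact: g01.
by split=> //; move=> y; exact: gN.
Qed.

Lemma tychonoff_prod_topology (I : Type) (T : I -> topologicalType) :
  (forall i, tychonoff_space (T i)) -> tychonoff_space (prod_topology T).
Proof.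
move=> tT; apply: nbhs_tychonoff.
  by apply: hausdorff_prod_topology => i; case: (tT i).
move=> x N; have FF := functionally_separated_filter x.
suff : functionally_separated x --> x by apply.
apply: cvg_prod_topology => i A xA.
by apply: functionally_separated_preimage (tychonoff_nbhs (tT i) xA);
  exact: prod_topology_eval_continuous.
Qed.

Lemma tychonoff_set_type (T : topologicalType) (A : set T) :
  tychonoff_space T -> tychonoff_space (set_type A).
Proof.
move=> tT; apply: nbhs_tychonoff.
  apply: (hausdorff_injective (@set_val_continuous _ A)); last by case: tT.
  exact: val_inj.
move=> x N; have FF := functionally_separated_filter x.
suff : functionally_separated x --> x by apply.
apply: cvg_initial => B xB.
by apply: functionally_separated_preimage (tychonoff_nbhs tT xB);
  exact: set_val_continuous.
Qed.

(** * Topological groups, their products and subgroups *)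

Section TopGroupTheory.
Variable G : topGroup.
Implicit Types x y z : G.

Lemma tg_mulgV x : tg_mul x (tg_inv x) = tg_one G.
Proof.
rewrite -[LHS]tg_mul1g -{1}(tg_mulVg (tg_inv x)).
by rewrite -tg_mulA (tg_mulA _ x) tg_mulVg tg_mul1g tg_mulVg.
Qed.

Lemma tg_mulg1 x : tg_mul x (tg_one G) = x.
Proof. by rewrite -(tg_mulVg x) tg_mulA tg_mulgV tg_mul1g. Qed.

Lemma tg_mulKg x y : tg_mul (tg_inv x) (tg_mul x y) = y.
Proof. by rewrite tg_mulA tg_mulVg tg_mul1g. Qed.

Lemma tg_mulVKg x y : tg_mul x (tg_mul (tg_inv x) y) = y.
Proof. by rewrite tg_mulA tg_mulgV tg_mul1g. Qed.

Lemma tg_mulgKV x y : tg_mul (tg_mul x (tg_inv y)) y = x.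
Proof. by rewrite -tg_mulA tg_mulVg tg_mulg1. Qed.

Lemma tg_mulgI x y z : tg_mul x y = tg_mul x z -> y = z.
Proof. by move=> xyz; rewrite -(tg_mulKg x y) xyz tg_mulKg. Qed.

Lemma continuous_tg_mul (S : topologicalType) (f g : S -> G) :
  continuous f -> continuous g -> continuous (fun s => tg_mul (f s) (g s)).
Proof.
move=> cf cg s; apply: (@continuous_comp _ _ _ (fun s => (f s, g s))
  (fun p : G * G => tg_mul p.1 p.2)); last exact: tg_mul_cont.
by apply: cvg_pair; [exact: cf|exact: cg].
Qed.

End TopGroupTheory.

Section Morphisms.
Variables (G H : topGroup) (h : G -> H).
Hypothesis hM : forall x y, h (tg_mul x y) = tg_mul (h x) (h y).

Lemma tg_hom1 : h (tg_one G) = tg_one H.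
Proof.
by apply: (@tg_mulgI _ (h (tg_one G))); rewrite -hM tg_mul1g tg_mulg1.
Qed.

Lemma tg_homV x : h (tg_inv x) = tg_inv (h x).
Proof.
by apply: (@tg_mulgI _ (h x)); rewrite -hM !tg_mulgV tg_hom1.
Qed.

End Morphisms.

Section ProductGroup.
Variables (I : Type) (Gs : I -> topGroup).
Local Notation P := (prod_topology (fun i => tg_car (Gs i))).

Let mul (x y : P) : P := fun i => tg_mul (x i) (y i).
Let inv (x : P) : P := fun i => tg_inv (x i).
Let one : P := fun i => tg_one (Gs i).

Let mulA x y z : mul x (mul y z) = mul (mul x y) z.
Proof. by apply: functional_extensionality_dep => i; exact: tg_mulA. Qed.

Let mul1 x : mul one x = x.
Proof. by apply: functional_extensionality_dep => i; exact: tg_mul1g. Qed.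

Let mulV x : mul (inv x) x = one.
Proof. by apply: functional_extensionality_dep => i; exact: tg_mulVg. Qed.

Let mul_cont : continuous (fun p : P * P => mul p.1 p.2).
Proof.
apply: continuous_prod_topology => i; apply: continuous_tg_mul => p.
  by apply: (@continuous_comp _ _ _ fst (fun p : P => p i));
    [exact: cvg_fst|exact: prod_topology_eval_continuous].
by apply: (@continuous_comp _ _ _ snd (fun p : P => p i));
  [exact: cvg_snd|exact: prod_topology_eval_continuous].
Qed.

Let inv_cont : continuous inv.
Proof.
apply: continuous_prod_topology => i p.
by apply: (@continuous_comp _ _ _ (fun p : P => p i) (@tg_inv (Gs i)));
  [exact: prod_topology_eval_continuous|exact: tg_inv_cont].
Qed.

Definition prod_topGroup : topGroup :=
  TopGroup mulA mul1 mulV mul_cont inv_cont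
    (tychonoff_prod_topology (fun i => tg_tychonoff (Gs i))).

End ProductGroup.

Section Subgroup.
Variables (P : topGroup) (A : set P).
Hypothesis A1 : A (tg_one P).
Hypothesis AM : forall x y, A x -> A y -> A (tg_mul x y).
Hypothesis AV : forall x, A x -> A (tg_inv x).
Local Notation S := (set_type A).

Let mul (x y : S) : S := SigSub (mem_set (AM (set_valP x) (set_valP y))).
Let inv (x : S) : S := SigSub (mem_set (AV (set_valP x))).
Let one : S := SigSub (mem_set A1).

Let mulA x y z : mul x (mul y z) = mul (mul x y) z.
Proof. by apply: val_inj; exact: tg_mulA. Qed.

Let mul1 x : mul one x = x.
Proof. by apply: val_inj; exact: tg_mul1g. Qed.

Let mulV x : mul (inv x) x = one.
Proof. by apply: val_inj; exact: tg_mulVg. Qed.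

Let mul_cont : continuous (fun p : S * S => mul p.1 p.2).
Proof.
apply: continuous_set_type; apply: continuous_tg_mul => p.
  by apply: (@continuous_comp _ _ _ fst (set_val : S -> P));
    [exact: cvg_fst|exact: set_val_continuous].
by apply: (@continuous_comp _ _ _ snd (set_val : S -> P));
  [exact: cvg_snd|exact: set_val_continuous].
Qed.

Let inv_cont : continuous inv.
Proof.
apply: continuous_set_type => p.
by apply: (@continuous_comp _ _ _ (set_val : S -> P) (@tg_inv P));
  [exact: set_val_continuous|exact: tg_inv_cont].
Qed.

Definition sub_topGroup : topGroup :=
  TopGroup mulA mul1 mulV mul_cont inv_cont
    (tychonoff_set_type A (tg_tychonoff P)).

Lemma sub_topGroup_embedding :
  cont_hom (set_val : sub_topGroup -> P) /\
  top_embedding (set_val : sub_topGroup -> P).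
Proof.
split; split.
- exact: set_val_continuous.
- by [].
- exact: val_inj.
- split; first exact: set_val_continuous.
  by move=> _ [V oV <-]; exists V.
Qed.

End Subgroup.

(** * Construction of the group [H] *)

(** [H] is the range of the diagonal map with the subspace topology of the product, so it lies in
    the class by multiplicativity and heredity. A neighborhood of its unit is obtained by
    restricting a single coordinate. *)
Lemma range_class_quotient (K : Type) (cls : tg_class) (G : topGroup)
    (A : set K) (O : K -> set G) :
  tau_multiplicative K cls -> hereditary cls -> range_class cls G ->
  (forall k, A k -> nbhs (tg_one G) (O k)) ->
  exists (H : topGroup) (phi : G -> H), [/\ cls H, epimorphism phi &
    forall k, A k -> exists2 V, nbhs (tg_one H) V & phi @^-1` V `<=` O k].
Proof.
move=> mul_cls her_cls rgG OA.
(* The group and the homomorphism are packed into one dependent pair, so that a single choice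
   selects both. Indexing by [{k | A k}], which [sval] injects into [K], keeps the number of factors
   at most tau. *)
have /choice[D DP] (i : {k | A k}) : exists D : {H : topGroup & G -> H},
    cls (projT1 D) /\ cont_hom (projT2 D) /\
    exists U : set (projT1 D), nbhs (tg_one _) U /\
      projT2 D @^-1` U `<=` O (sval i).
  have [H [h [? [? ?]]]] := rgG _ (OA _ (svalP i)).
  by exists (existT _ H h).
pose Gs i := projT1 (D i).
pose P := prod_topGroup Gs.
have clsP : cls P.
  apply: (mul_cls _ (@sval K A) _ Gs _ P id).
  - by move=> [k Ak] [l Al] /= kl; exact: eq_exist.
  - by move=> i; case: (DP i).
  - by [].
  - by move=> x; exact: cvg_id.
  - exists (id : prod_topology (fun i => tg_car (Gs i)) -> P).
    by split=> //; split=> // x; exact: cvg_id.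
pose f (g : G) : P := fun i => projT2 (D i) g.
have fM x y : f (tg_mul x y) = tg_mul (f x) (f y).
  apply: functional_extensionality_dep => i.
  by case: (DP i) => _ [[_ hM] _]; exact: hM.
have cf : continuous f.
  by apply: continuous_prod_topology => i; case: (DP i) => _ [[? _] _].
have A1 : range f (tg_one P) by exists (tg_one G) => //; exact: tg_hom1.
have AM x y : range f x -> range f y -> range f (tg_mul x y).
  by move=> [g _ <-] [h _ <-]; exists (tg_mul g h).
have AV x : range f x -> range f (tg_inv x).
  by move=> [g _ <-]; exists (tg_inv g) => //; exact: tg_homV.
have [vM vE] := sub_topGroup_embedding A1 AM AV.
pose H := sub_topGroup A1 AM AV.
have fr g : range f (f g) by exists g.
pose phi (g : G) : H := SigSub (mem_set (fr g)).
exists H, phi; split.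
- exact: her_cls clsP vM vE.
- split; first split.
  + by apply: (@continuous_set_type _ _ _ phi); exact: cf.
  + by move=> x y; apply: val_inj; exact: fM.
  + by move=> y; have [g _ gy] := set_valP y; exists g; exact: val_inj.
- move=> k Ak; pose i : {k | A k} := exist _ k Ak.
  have [_ [_ [U [U1 UO]]]] := DP i.
  exists ((fun y : H => (set_val y : P) i) @^-1` U).
    apply: (@continuous_comp _ _ _ (set_val : H -> P) (fun p : P => p i)).
    + exact: set_val_continuous.
    + exact: prod_topology_eval_continuous.
    + exact: U1.
  by move=> g; exact: UO.
Qed.

Lemma nbhs_tg_mulr (G : topGroup) (g : G) (O : set G) :
  nbhs (tg_one G) O -> nbhs g [set h | O (tg_mul h (tg_inv g))].
Proof.
move=> O1; have c : continuous (fun h => tg_mul h (tg_inv g)).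
  by apply: continuous_tg_mul => h; [exact: cvg_id|exact: cvg_cst].
by apply: c; rewrite tg_mulgV.
Qed.

(** * Descent of an action to [H] and its continuity *)

(** Continuity is left out because the action of [H] is first defined algebraically; each case then
    has its own argument for joint continuity. *)
Definition alg_action (G : topGroup) (X : Type) (a : G -> X -> X) :=
  (forall x, a (tg_one G) x = x) /\
  (forall g h x, a g (a h x) = a (tg_mul g h) x).

Lemma is_action_continuous (G : topGroup) (X : topologicalType)
    (a : G -> X -> X) (g : G) : is_action a -> continuous (a g).
Proof.
move=> [_ [_ ca]] x; apply: (@continuous_comp _ _ _ (fun y => (g, y))
  (fun p : G * X => a p.1 p.2)); last exact: ca.
by apply: cvg_pair; [exact: cvg_cst|exact: cvg_id].
Qed.

(** An element [h] acts through a chosen preimage [s h]. The choice is immaterial: [g] equals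
    [s (phi g)] times an element of the kernel, which acts trivially. *)
Lemma alg_action_descends (G H : topGroup) (X : Type) (a : G -> X -> X)
    (phi : G -> H) : alg_action a -> epimorphism phi ->
  (forall g, phi g = tg_one H -> forall x, a g x = x) ->
  exists2 c : H -> X -> X, alg_action c & forall g x, a g x = c (phi g) x.
Proof.
move=> [a1 aM] [[_ phiM] /choice[s sK]] ker.
pose c h x := a (s h) x.
have ac g x : a g x = c (phi g) x.
  rewrite /c -{1}(tg_mulVKg (s (phi g)) g) -aM.
  by rewrite [X in a _ X]ker // phiM tg_homV // sK tg_mulVg.
exists c => //; split=> [x|g h x]; first by rewrite -(tg_hom1 phiM) -ac.
by rewrite /c aM ac phiM !sK.
Qed.

Section TransitiveContinuity.
Variables (G : topGroup) (X : topologicalType) (c : G -> X -> X) (x0 : X).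
Hypothesis cA : alg_action c.
Hypothesis c_cont : forall g, continuous (c g).
Hypothesis c_trans : transitive_action c.

(* [c h y = g t . (t^-1 g^-1 h t) . t^-1 y] carries the point [(g, t x0)] to
   [(1, x0)]. *)
Lemma transitive_is_action :
  (forall N, nbhs x0 N -> exists (O : set G) (W : set X),
    [/\ nbhs (tg_one G) O, nbhs x0 W & act_set c O W `<=` N]) ->
  is_action c.
Proof.
move=> c0; have [c1 cM] := cA; do 2 (split=> //).
move=> [g x] N /= Ngx; have [t tx] := c_trans x0 x.
have : nbhs x0 (c (tg_mul g t) @^-1` N).
  by apply: c_cont; rewrite -cM tx.
move=> /c0[ O [W [ O1 W1 OW]]].
pose m h := tg_mul (tg_mul (tg_inv (tg_mul g t)) h) t.
have cm : continuous m.
  apply: continuous_tg_mul => h; last exact: cvg_cst.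
  by apply: (@continuous_tg_mul _ _ (cst _) id) h => h;
    [exact: cvg_cst|exact: cvg_id].
exists (m @^-1` O, c (tg_inv t) @^-1` W) => /=.
  split=> /=.
    apply: cm; suff -> : m g = tg_one G by [].
    by rewrite /m -tg_mulA tg_mulVg.
  by apply: c_cont; rewrite -tx cM tg_mulVg c1.
move=> [h y] [/= Oh Wy].
have : N (c (tg_mul g t) (c (m h) (c (tg_inv t) y))).
  by apply: OW; exists (m h), (c (tg_inv t) y).
by rewrite !cM /m -!tg_mulA tg_mulgV tg_mulg1 tg_mulA tg_mulVKg.
Qed.

End TransitiveContinuity.

Lemma uniformity_separates (X : topologicalType) (U : set (set (set X)))
    (x y : X) : uniformity U ->
  (forall u, U u -> exists V, [/\ u V, V x & V y]) -> x = y.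
Proof.
move=> [_ [_ [_ [_ [_ [sepU _]]]]]] xy.
apply: contrapT => /sepU[u /xy[V [uV Vx Vy]]].
by move=> /(_ V uV); apply.
Qed.

(** For [h] near [g] and [y] near [x], write [h y = (h g^-1) (g y)] with [h g^-1] in [O] and [g y]
    in [V]. Boundedness puts this point and [g x] in one member of the cover [u]. *)
Lemma equiuniform_is_action (G : topGroup) (X : topologicalType)
    (c : G -> X -> X) (U : set (set (set X))) :
  alg_action c -> (forall g, continuous (c g)) -> equiuniformity c U ->
  is_action c.
Proof.
move=> [c1 cM] c_cont [uU satU bndU]; do 2 (split=> //).
have [_ [covU [_ [_ [_ [_ nbhsU]]]]]] := uU.
move=> [g x] N /= /nbhsU[u Uu uN].
have [ O [v [ O1 [Uv Ovu]]]] := bndU _ Uu.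
have [ov cv] := covU _ Uv.
have [V vV Vgx] := cv (c g x).
have [|W uW OVW] := Ovu (act_set c O V); first by exists V.
exists ([set h | O (tg_mul h (tg_inv g))], c g @^-1` V).
  split; first exact: nbhs_tg_mulr.
  by apply: c_cont; apply: open_nbhs_nbhs; split=> //; exact: ov.
move=> [h y] [/= Oh Vy]; apply: uN; exists W => /=.
  split=> //; exists (c g x); split=> //; apply: OVW.
  by exists (tg_one G), (c g x); rewrite c1; split=> //; exact: nbhs_singleton.
apply: OVW; exists (tg_mul h (tg_inv g)), (c g y).
by rewrite cM tg_mulgKV.
Qed.

(** * The two cases, apart from the compactification *)

Lemma transitive_case (K : Type) (cls : tg_class) (G : topGroup)
    (X : topologicalType) (a : G -> X -> X) :
  tau_multiplicative K cls -> hereditary cls -> range_class cls G ->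
  hausdorff_space X -> is_action a -> transitive_action a ->
  character_le K X ->
  exists (H : topGroup) (c : H -> X -> X) (phi : G -> H),
    [/\ cls H, is_action c, transitive_action c, epimorphism phi &
        forall g x, a g x = c (phi g) x].
Proof.
move=> mul_cls her_cls rgG hX aA a_trans chX.
have [a1 [aM ca]] := aA.
(* Transitivity does not exclude an empty [X]. There is then no base point, and the construction is
   run with an empty family of neighborhoods. *)
have [[x0 _]|X0] := pselect (exists x : X, True); last first.
  have [//|H [phi [clsH epi _]]] := @range_class_quotient K cls G set0
    (fun=> setT) mul_cls her_cls rgG.
  exists H, (fun _ x => x), phi; split=> //.
  - by do 2 (split=> //); move=> [g x]; exact: cvg_snd.
  - by move=> x; case: X0; exists x.
  - by move=> g x; case: X0; exists x.
have [A [B [AB Bx0]]] := chX x0.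
(* Joint continuity at [(1, x0)] gives the pair for [k] in [A]; outside [A] the value [(setT, setT)]
   is a mere default. *)
have /choice[ OW OWP] (k : K) : exists OW : set G * set X, A k ->
    [/\ nbhs (tg_one G) OW.1, nbhs x0 OW.2 & act_set a OW.1 OW.2 `<=` B k].
  have [Ak|nAk] := pselect (A k); last by exists (setT, setT).
  have [oB Bkx] := AB _ Ak.
  have : nbhs (a (tg_one G) x0) (B k).
    by rewrite a1; apply: open_nbhs_nbhs.
  move=> /(ca (tg_one G, x0))[[ O W] /= [ O1 W1] OW].
  exists (O, W) => _; split=> //= z.
  by move=> [g [y [ Og [Wy ->]]]]; exact: (OW (g, y)).
have [|H [phi [clsH epi HO]]] :=
  @range_class_quotient K cls G A (fun k => (OW k).1) mul_cls her_cls rgG.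
  by move=> k /OWP[].
have [[cphi phiM] phi_surj] := epi.
have [|c cA ac] := alg_action_descends (conj a1 aM) epi.
  (* A kernel element lies in every [O_k], so it moves [x0] into every basic neighborhood of [x0];
     as [X] is Hausdorff, [x0] is fixed. *)
  have ker0 g : phi g = tg_one H -> a g x0 = x0.
    move=> phig; apply/esym/hX => M N Mx Ngx.
    suff : M (a g x0) by exists (a g x0); split=> //; exact: nbhs_singleton.
    have [k Ak BM] := Bx0 _ Mx; apply: BM; have [ O1 W1 OWB] := OWP _ Ak.
    apply: OWB; exists g, x0; split; last by split=> //; exact: nbhs_singleton.
    have [V V1 VO] := HO _ Ak; apply: VO; rewrite /= phig.
    exact: nbhs_singleton.
  (* The kernel is normal: [t^-1 g t] fixes [x0], hence [g] fixes [t x0]. *)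
  move=> g phig x; have [t <-] := a_trans x0 x.
  rewrite aM -{1}(tg_mulVKg t (tg_mul g t)) -aM.
  by rewrite [X in a _ X]ker0 // !phiM phig tg_mul1g tg_homV // tg_mulVg.
have c_trans : transitive_action c.
  by move=> x y; have [g <-] := a_trans x y; exists (phi g); rewrite ac.
exists H, c, phi; split=> //.
apply: (@transitive_is_action _ _ _ x0) => //.
  move=> h; have [g <-] := phi_surj h.
  have -> : c (phi g) = a g by apply/funext => x; rewrite ac.
  exact: is_action_continuous.
move=> N /Bx0[k Ak BN]; have [ O1 W1 OWB] := OWP _ Ak.
have [V V1 VO] := HO _ Ak.
(* Any preimage [g] of a point of [V] lies in [O_k], so [V W_k] is contained in [O_k W_k]. *)
exists V, (OW k).2; split=> // z [h [y [Vh [Wy ->]]]]; apply: BN.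
have [g gh] := phi_surj h; rewrite -gh -ac; apply: OWB.
by exists g, y; split=> //; apply: VO; rewrite /= gh.
Qed.

Lemma equiuniform_case (K : Type) (cls : tg_class) (G : topGroup)
    (X : topologicalType) (a : G -> X -> X) (U : set (set (set X))) :
  tau_multiplicative K cls -> hereditary cls -> range_class cls G ->
  is_action a -> equiuniformity a U -> uniformity_weight_le K U ->
  exists (H : topGroup) (c : H -> X -> X) (phi : G -> H),
    [/\ cls H, is_action c, equiuniformity c U, epimorphism phi &
        forall g x, a g x = c (phi g) x].
Proof.
move=> mul_cls her_cls rgG aA [uU satU bndU] [A [B [AB BU]]].
have [a1 [aM ca]] := aA.
have /choice[ Ov OvP] (k : K) : exists Ov : set G * set (set X), A k ->
    [/\ nbhs (tg_one G) Ov.1, U Ov.2 &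
        refines [set act_set a Ov.1 V | V in Ov.2] (B k)].
  have [Ak|nAk] := pselect (A k); last by exists (setT, setT).
  by have [ O [v [? [? ?]]]] := bndU _ (AB _ Ak); exists (O, v).
have [|H [phi [clsH epi HO]]] :=
  @range_class_quotient K cls G A (fun k => (Ov k).1) mul_cls her_cls rgG.
  by move=> k /OvP[].
have [[cphi phiM] phi_surj] := epi.
have [|c cA ac] := alg_action_descends (conj a1 aM) epi.
  (* A kernel element [g] lies in every [O_k]; so [x] and [g x] both lie in [O_k V] for a member [V]
     of [v_k] containing [x], hence in a common member of every cover. *)
  move=> g phig x; apply: (uniformity_separates uU) => u /BU[k Ak Bu].
  have [ O1 Uv OvB] := OvP _ Ak.
  have [_ [/(_ _ Uv)[_ /(_ x)[V vV Vx]] _]] := uU.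
  have [|W BW OVW] := OvB (act_set a (Ov k).1 V); first by exists V.
  have [W' uW' WW'] := Bu _ BW.
  exists W'; split=> //; apply: WW'; apply: OVW.
    exists g, x; split=> //; have [V' V1 VO] := HO _ Ak; apply: VO.
    by rewrite /= phig; exact: nbhs_singleton.
  by exists (tg_one G), x; rewrite a1; split=> //; exact: nbhs_singleton.
(* As [phi] is onto, [G] and [H] act by the same self-maps of [X]; saturation and separate
   continuity therefore carry over. *)
have cE g : c (phi g) = a g by apply/funext => x; rewrite ac.
have cU : equiuniformity c U.
  split=> // [h u Uu|u /BU[k Ak Bu]].
    by have [g <-] := phi_surj h; rewrite cE; exact: satU.
  have [ O1 Uv OvB] := OvP _ Ak; have [V V1 VO] := HO _ Ak.
  exists V, (Ov k).2; split=> //; split=> // _ [W vW <-].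
  have [|W' BW' OWW'] := OvB (act_set a (Ov k).1 W); first by exists W.
  have [W'' uW'' WW''] := Bu _ BW'.
  exists W'' => // z [h [y [Vh [Wy ->]]]]; apply/WW''/OWW'.
  have [g gh] := phi_surj h; exists g, y; rewrite ac gh; split=> //.
  by apply: VO; rewrite /= gh.
exists H, c, phi; split=> //; apply: equiuniform_is_action cU => // h.
by have [g <-] := phi_surj h; rewrite cE; exact: is_action_continuous.
Qed.

(** * Uniformly continuous functions separating points from sets *)

Section UniformUrysohn.
Local Open Scope ring_scope.
Variable R : realType.

(** The entourage [E] generates a countably based uniformity, its gauge, which comes from a
    pseudometric. The function is the distance to [x], divided by the radius of a ball inside [E]
    and truncated at 1. *)
Lemma uniform_urysohn (T : uniformType) (E : set (T * T)) (x : T) :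
  entourage E -> exists f : T -> R,
    [/\ forall y, 0 <= f y <= 1, f x = 0, forall y, ~ E (x, y) -> f y = 1 &
        forall e, 0 < e -> exists2 D, entourage D &
          forall y z, D (y, z) -> `|f y - f z| <= e].
Proof.
move=> entE; pose T' : pseudoMetricType R := gauge.type entE.
have [eps eps0 epsE] : exists2 eps : R, 0 < eps &
    forall y, @ball R T' x eps y -> E (x, y).
  have : @entourage T' E by exists 0%N => //= ? [].
  rewrite -entourage_ballE => -[eps eps0 epsE]; exists eps => // y xy.
  exact: (epsE (x, y)).
(* Any two points are within distance 2 for the gauge pseudometric, so the extended distance is
   finite. *)
have dfin y z : @edist R T' (y, z) \is a fin_num.
  apply/edist_finP; exists 2 => //.
  exact: countable_uniform.countable_uniform_bounded.
pose d y : R := fine (@edist R T' (x, y)).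
have d0 y : 0 <= d y by apply: fine_ge0; exact: edist_ge0.
have d_lip r y z : 0 < r -> @ball R T' y r z -> d z <= d y + r.
  move=> r0 yz; rewrite /d -lee_fin EFinD !fineK //.
  apply: (le_trans (@edist_triangle _ T' x y z)).
  by rewrite leeD2l // (@edist_fin _ T' r (y, z)).
pose f y := Num.min (d y / eps) 1.
have f_lip r y z : 0 < r -> @ball R T' y (r * eps) z -> f z <= f y + r.
  move=> r0 /d_lip-/(_ (mulr_gt0 r0 eps0)) dz.
  rewrite /f ge_min; case: (leP (d y / eps) 1) => _.
    by rewrite ler_pdivrMr // mulrDl divfK ?gt_eqF // dz.
  by rewrite lerDl (ltW r0) orbT.
exists f; split.
- by move=> y; rewrite /f le_min ler01 divr_ge0 ?(ltW eps0) //= ge_min lexx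
  orbT.
- by rewrite /f /d edist_refl mul0r; apply/min_idPl.
- move=> y nEy; apply/min_idPr; rewrite ler_pdivlMr // mul1r leNgt.
  apply/negP => dy; apply/nEy/epsE/(@edist_lt_ball R T' eps (x, y)).
  by rewrite -(fineK (dfin x y)) lte_fin.
- move=> e e0; exists [set yz | @ball R T' yz.1 (e * eps) yz.2].
    apply: (gauge.gauge_ent entE).
    exact: (@entourage_ball R T' (PosNum (mulr_gt0 e0 eps0))).
  move=> y z /= yz; rewrite ler_norml lerBlDr lerNl opprB lerBlDr.
  rewrite ![e + _]addrC !f_lip //.
  exact: ball_sym.
Qed.

End UniformUrysohn.

(** A copy of [X], so that the uniform structure and the topology it induces do not clash with the
    given topology. The proof [uU] is a parameter because the uniform instance depends on it. *)
Definition cover_uniform (X : topologicalType) (U : set (set (set X)))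
  (uU : uniformity U) : Type := X.

Section CoverUniformity.
Local Open Scope relation_scope.
Variables (X : topologicalType) (U : set (set (set X))).
Hypothesis uU : uniformity U.

Definition cover_entourage : set_system (X * X) :=
  [set E | exists2 u, U u & forall V, u V -> V `*` V `<=` E].

Lemma cover_entourage_filter : Filter cover_entourage.
Proof.
have [[u Uu] [_ [_ [capU _]]]] := uU.
split.
- by exists u.
- move=> A B [u1 Uu1 u1A] [u2 Uu2 u2B].
  have [v Uv [vu1 vu2]] := capU _ _ Uu1 Uu2.
  exists v => // V vV [x y] [Vx Vy]; split.
    by have [W uW VW] := vu1 _ vV; apply: (u1A W) => //; split; exact: VW.
  by have [W uW VW] := vu2 _ vV; apply: (u2B W) => //; split; exact: VW.
- by move=> A B AB [v Uv vA]; exists v => // V vV;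
    exact: subset_trans (vA V vV) AB.
Qed.

Lemma cover_entourage_refl E : cover_entourage E -> diagonal `<=` E.
Proof.
move=> [u Uu uE] [x y] /diagonalP ->; have [_ [covU _]] := uU.
by have [_ /(_ y)[V uV Vy]] := covU _ Uu; exact: (uE V).
Qed.

Lemma cover_entourage_inv E : cover_entourage E -> cover_entourage E^-1.
Proof.
by move=> [u Uu uE]; exists u => // V uV [x y] [Vx Vy]; apply: (uE V uV).
Qed.

(** Take a star refinement [v] of [u]: two members of [v] sharing the middle point [z] both lie in
    the star of the first one, hence in one member of [u]. *)
Lemma cover_entourage_split E : cover_entourage E ->
  exists2 D, cover_entourage D & D \; D `<=` E.
Proof.
move=> [u Uu uE]; have [_ [_ [_ [_ [starU _]]]]] := uU.
have [v Uv vu] := starU _ Uu.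
exists [set p | exists2 V, v V & (V `*` V) p].
  by exists v => // V vV p Vp; exists V.
move=> [x y] [z [V /= vV [/= Vx Vz]] [W /= vW [/= Wz Wy]]].
have [|S uS VS] := vu (star V v); first by exists V.
apply: (uE S uS); split; apply: VS.
  by exists V => //; split=> //; exists x.
by exists W => //; split=> //; exists z.
Qed.

HB.instance Definition _ := Choice.on (cover_uniform uU).
HB.instance Definition _ := isUniform.Build (cover_uniform uU)
  cover_entourage_filter cover_entourage_refl
  cover_entourage_inv cover_entourage_split.

End CoverUniformity.

Section UniformFunctions.
Local Open Scope ring_scope.
Variable R : realType.
Variables (X : topologicalType) (U : set (set (set X))).

Definition cover_unif_continuous (f : X -> R) := forall e, 0 < e ->
  exists2 u, U u & forall V x y, u V -> V x -> V y -> `|f x - f y| <= e.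

(** The union of the squares [V * V] over [u] is an entourage whose section at [x] is the star of
    [x]. *)
Lemma cover_urysohn (u : set (set X)) (x : X) : uniformity U -> U u ->
  exists f : X -> R, [/\ forall y, 0 <= f y <= 1, cover_unif_continuous f,
    f x = 0 & forall y, ~ star [set x] u y -> f y = 1].
Proof.
move=> uU Uu; pose E := [set p : X * X | exists2 V, u V & (V `*` V) p].
have entE : @entourage (cover_uniform uU) E.
  by exists u => // V uV p Vp; exists V.
have [f [f01 fx fE fU]] := @uniform_urysohn R (cover_uniform uU) E x entE.
exists f; split=> // [e /fU[D [v Uv vD] Df]|y nxy].
  by exists v => // V y z vV Vy Vz; apply: Df; apply: (vD V vV).
apply: fE => -[V uV [/= Vx Vy]]; apply: nxy.
by exists V => //; split=> //; exists x.
Qed.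

Lemma cover_unif_continuous_continuous (f : X -> R) :
  uniformity U -> cover_unif_continuous f -> continuous f.
Proof.
move=> [_ [covU _]] fU x; apply/cvgrPdist_le => e /fU[u Uu uf].
have [ou /(_ x)[V uV Vx]] := covU _ Uu.
apply: filterS (open_nbhs_nbhs (conj (ou _ uV) Vx)) => y Vy.
exact: (uf V).
Qed.

End UniformFunctions.

(** * The equivariant compactification for [H] *)

Lemma compact_set_type (T : topologicalType) (A : set T) :
  compact A -> compact [set: set_type A].
Proof.
move=> cA F FF _; pose v : set_type A -> T := set_val.
have [|p [Ap clp]] := cA (v @ F) (fmap_proper_filter v FF).
  suff : F (v @^-1` A) by [].
  by apply: (@filterS _ F _ setT) filterT => x _; exact: (set_valP x).
exists (SigSub (mem_set Ap)); split=> // B N FB [_ [[W oW <-] Wp WN]].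
have [||_ [[x Bx <-] Wx]] := clp (v @` B) W.
- suff : F (v @^-1` (v @` B)) by [].
  by apply: filterS FB => x Bx; exists x.
- by apply: open_nbhs_nbhs; split.
by exists x; split=> //; exact: WN.
Qed.

Section SamuelCompactification.
Local Open Scope ring_scope.
Variables (R : realType) (G : topGroup) (X : topologicalType) (c : G -> X -> X).
Variable U : set (set (set X)).
Hypothesis cA : is_action c.
Hypothesis cU : equiuniformity c U.

Let uU : uniformity U. Proof. by case: cU. Qed.
Let c1 x : c (tg_one G) x = x. Proof. by case: cA. Qed.
Let cM g h x : c g (c h x) = c (tg_mul g h) x. Proof. by case: cA => _ []. Qed.

Definition unit_unif_fun :=
  {f : X -> R | (forall x, 0 <= f x <= 1) /\ cover_unif_continuous U f}.
Local Notation F := unit_unif_fun.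
Local Notation cube := (prod_topology (fun _ : F => R)).

Lemma translate_subproof (g : G) (f : F) :
  (forall x, 0 <= (sval f \o c g) x <= 1) /\
  cover_unif_continuous U (sval f \o c g).
Proof.
have [_ satU _] := cU; case: f => f [f01 fU] /=.
split=> [x|e /fU[u Uu uf]]; first exact: f01.
(* Applying [g] sends [g^-1 V] back to [V], where [f] varies by at most [e]. *)
exists [set c (tg_inv g) @` V | V in u]; first exact: satU.
move=> _ _ _ [V uV <-] [x Vx <-] [y Vy <-].
by rewrite /= !cM !tg_mulgV !c1; exact: (uf V).
Qed.

Definition translate (g : G) (f : F) : F := exist _ _ (translate_subproof g f).

Lemma translate1 f : translate (tg_one G) f = f.
Proof.
case: f => f fP; apply: eq_exist; apply/funext => x /=.
by rewrite c1.
Qed.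

(** Precomposition reverses the order, so this is a right action on functions; evaluating points of
    the cube at translates reverses it again, and [cube_shift] becomes a left action. *)
Lemma translateM g h f : translate h (translate g f) = translate (tg_mul g h) f.
Proof. by apply: eq_exist; apply/funext => x /=; rewrite cM. Qed.

(** By boundedness [h x = (h g^-1) (g x)] and [g x] lie in one set on which [f] varies by at most
    [e]. The neighborhood of [g] does not depend on [x]. *)
Lemma translate_near (g : G) (f : F) (e : R) : 0 < e ->
  nbhs g [set h | forall x,
    `|sval (translate h f) x - sval (translate g f) x| <= e].
Proof.
move=> e0; have [_ _ bndU] := cU; case: f => f [f01 fU] /=.
have [u Uu uf] := fU _ e0.
have [ O [v [ O1 [Uv Ovu]]]] := bndU _ Uu.
apply: filterS (nbhs_tg_mulr g O1) => h /= Oh x.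
have [_ [/(_ _ Uv)[_ /(_ (c g x))[V vV Vgx]] _]] := uU.
have [|W uW OVW] := Ovu (act_set c O V); first by exists V.
apply: (uf W) => //; apply: OVW.
  by exists (tg_mul h (tg_inv g)), (c g x); rewrite cM tg_mulgKV.
by exists (tg_one G), (c g x); rewrite c1; split=> //; exact: nbhs_singleton.
Qed.

Definition cube_ev (x : X) : cube := fun f => sval f x.

Local Notation bX := (set_type (closure (range cube_ev))).

Lemma cube_ev_continuous : continuous cube_ev.
Proof.
apply: continuous_prod_topology => -[f [f01 fU]].
exact: cover_unif_continuous_continuous fU.
Qed.

(** The conclusion is a closed condition on two coordinates of [y], so a bound valid at all points
    of [X] passes to the closure. *)
Lemma cube_closure_near (y : cube) (f1 f2 : F) (e : R) :
  closure (range cube_ev) y -> (forall x, `|sval f1 x - sval f2 x| <= e) ->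
  `|y f1 - y f2| <= e.
Proof.
move=> yX f12; apply/ler_addgt0Pr => d d0.
have [|_ [[x _ <-] [/= xf1 xf2]]] := yX [set z : cube |
    `|y f1 - z f1| <= d / 2 /\ `|y f2 - z f2| <= d / 2].
  have d2 : 0 < d / 2 by rewrite divr_gt0.
  have ev i := @prod_topology_eval_continuous F (fun=> R) i y.
  by apply: filterI; [move: (ev f1)|move: (ev f2)] => /cvgrPdist_le; apply.
have -> : y f1 - y f2 = (sval f1 x - sval f2 x) +
    ((y f1 - sval f1 x) - (y f2 - sval f2 x)).
  by ring.
rewrite (le_trans (ler_normD _ _)) // lerD //.
by rewrite (le_trans (ler_normB _ _)) // [d]splitr lerD.
Qed.

(** On the evaluation at [x] this gives the evaluation at [c g x], so it extends the action from [X]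
    to the whole cube. *)
Definition cube_shift (g : G) (y : cube) : cube := fun f => y (translate g f).

Lemma cube_shift_continuous g : continuous (cube_shift g).
Proof.
apply: continuous_prod_topology => f.
exact: (@prod_topology_eval_continuous F (fun=> R)).
Qed.

Lemma cube_shift_closure g y :
  closure (range cube_ev) y -> closure (range cube_ev) (cube_shift g y).
Proof.
move=> yX N /(cube_shift_continuous (x := y)) /yX[_ [[x _ <-] Nx]].
by exists (cube_ev (c g x)); split=> //; exists (c g x).
Qed.

Definition samuel_act (g : G) (y : bX) : bX :=
  SigSub (mem_set (cube_shift_closure (g := g) (set_valP y))).

Lemma samuel_is_action : is_action samuel_act.
Proof.
split; last split.
- move=> y; apply: val_inj; apply/funext => f /=.
  by rewrite /cube_shift translate1.
- move=> g h y; apply: val_inj; apply/funext => f /=.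
  by rewrite /cube_shift translateM.
apply: continuous_set_type; apply: continuous_prod_topology => f [g y].
apply/cvgrPdist_le => e e0; have e2 : 0 < e / 2 by rewrite divr_gt0.
(* The first argument varies over [A] and the second over [B]. Moving from [g] to [h] costs at most
   [e / 2] at every point of the closure, and moving from [y] to [z] at most [e / 2] in the
   coordinate [translate g f]. *)
pose A := [set h | forall x,
  `|sval (translate h f) x - sval (translate g f) x| <= e / 2].
pose B := [set z : bX |
  `|set_val y (translate g f) - set_val z (translate g f)| <= e / 2].
have yB : nbhs y B.
  have := @continuous_comp _ _ _ (set_val : bX -> cube)
    (fun p : cube => p (translate g f)) y (@set_val_continuous _ _ y)
    (@prod_topology_eval_continuous F (fun=> R) _ _).
  by move=> /cvgrPdist_le; apply.
exists (A, B); first by split; [exact: translate_near|exact: yB].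
move=> [h z] [/= hg yz]; rewrite /cube_shift.
have := cube_closure_near (set_valP z) hg.
rewrite distrC => hz; rewrite [e]splitr.
by rewrite (le_trans (ler_distD (set_val z (translate g f)) _ _)) // lerD.
Qed.

Lemma cube_compact : compact [set y : cube | forall f, [set` `[0, 1]] (y f)].
Proof.
apply: (@tychonoff {classic F} (fun=> R) (fun=> [set` `[0, 1]])) => _.
exact: segment_compact.
Qed.

Lemma closure_ev_compact : compact (closure (range cube_ev)).
Proof.
have hC : hausdorff_space cube.
  by apply: hausdorff_prod_topology => _; exact: Rhausdorff.
apply: (subclosed_compact _ cube_compact); first exact: closed_closure.
rewrite [X in _ `<=` X](closure_id _).1; last first.
  exact: compact_closed cube_compact.
by apply: closureS => _ [x _ <-] [f [f01 fU]] /=; rewrite in_itv /= f01.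
Qed.

Lemma equiuniformity_G_tychonoff : G_tychonoff c.
Proof.
have evX x : closure (range cube_ev) (cube_ev x).
  by apply: subset_closure; exists x.
pose j (x : X) : bX := SigSub (mem_set (evX x)).
have cj : continuous j.
  by apply: continuous_set_type; exact: cube_ev_continuous.
(* These coordinates serve twice: they show that [j] is injective and that its inverse is continuous
   on the image. *)
have sep (x : X) (u : set (set X)) : U u -> exists f : F,
    sval f x = 0 /\ forall y, ~ star [set x] u y -> sval f y = 1.
  move=> Uu; have [f [f01 fU fx fu]] := @cover_urysohn R _ _ _ x uU Uu.
  by exists (exist _ f (conj f01 fU)).
exists bX, j, samuel_act; split; last split; last split; last split; last split.
- exact: compact_set_type closure_ev_compact.
- apply: (hausdorff_injective (@set_val_continuous _ _) val_inj).
  by apply: hausdorff_prod_topology => _; exact: Rhausdorff.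
- split; last split=> // O oO.
    move=> x y jxy; apply: contrapT => xy.
    have [_ [_ [_ [_ [_ [/(_ _ _ xy)[u Uu uxy] _]]]]]] := uU.
    have [f [fx fy]] := sep x u Uu.
    have : cube_ev x f = cube_ev y f by move: jxy => [->].
    rewrite /cube_ev fx fy => [/esym/eqP|]; first by rewrite oner_eq0.
    by move=> [V [uV [z [Vz zx]]] Vy]; apply: (uxy V uV); rewrite -zx.
  (* The largest open set whose preimage lies in [O]. It covers [O], since around [x] the condition
     that coordinate [f] be below 1 confines points of [X] to a star inside [O]. *)
  exists (\bigcup_(W in [set W | open W /\ j @^-1` W `<=` O]) W).
  split; first by apply: bigcup_open => W [].
  apply/seteqP; split=> [x [W [_ WO] Wx]|x Ox]; first exact: WO.
  have [_ [_ [_ [_ [_ [_ nbhsU]]]]]] := uU.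
  have [u Uu uO] := nbhsU _ _ (open_nbhs_nbhs (conj oO Ox)).
  have [f [fx fy]] := sep x u Uu.
  exists ((fun y : bX => (set_val y : cube) f) @^-1` [set r | r < 1]);
    last first.
    by suff : sval f x < 1 by []; rewrite fx ltr01.
  split.
    apply: open_comp; last exact: open_lt.
    move=> y _; apply: (@continuous_comp _ _ _ (set_val : bX -> cube)
      (fun p : cube => p f)); first exact: set_val_continuous.
    exact: (@prod_topology_eval_continuous F (fun=> R)).
  move=> y yf; apply: uO; apply: contrapT => /fy fy1.
  by have : sval f y < 1 by []; rewrite fy1 ltxx.
- move=> N [y Ny] [W oW WN]; rewrite -WN in Ny *.
  have [|_ [[x _ <-] Wx]] := set_valP y W.
    by apply: open_nbhs_nbhs; split.
  by exists (j x); split=> //; exists x.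
- exact: samuel_is_action.
- by move=> g x; exact: val_inj.
Qed.

End SamuelCompactification.

Theorem theorem3p3 (K : Type) (cls : tg_class) (G : topGroup) :
  infinite_set [set: K] ->
  tau_multiplicative K cls -> hereditary cls -> range_class cls G ->
  (* case (a) *)
  (forall (X : topologicalType) (a : G -> X -> X),
     tychonoff_space X -> is_action a -> transitive_action a ->
     character_le K X ->
     exists (H : topGroup) (c : H -> X -> X) (phi : G -> H),
       [/\ cls H, is_action c, transitive_action c, epimorphism phi &
           forall g x, a g x = c (phi g) x]) /\
  (* case (b) *)
  (forall (X : topologicalType) (a : G -> X -> X) (U : set (set (set X))),
     tychonoff_space X -> is_action a -> G_tychonoff a ->
     equiuniformity a U -> uniformity_weight_le K U ->
     exists (H : topGroup) (c : H -> X -> X) (phi : G -> H),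
       [/\ cls H, is_action c /\ G_tychonoff c, equiuniformity c U,
           epimorphism phi & forall g x, a g x = c (phi g) x]).
Proof.
move=> _ mul_cls her_cls rgG; split=> [X a tX|X a U tX aA _ eU wU].
  by apply: transitive_case mul_cls her_cls rgG _; case: tX.
have [H [c [phi [clsH cA cU epi ac]]]] :=
  equiuniform_case mul_cls her_cls rgG aA eU wU.
exists H, c, phi; split=> //; split=> //.
exact: (@equiuniformity_G_tychonoff Rdefinitions.R _ _ _ _ cA cU).
Qed.
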